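(* Let $\mathbb F$ be a field and let $\hat H$ be the universal double affine Hecke algebra of type $(C_1^\vee,C_1)$ over $\mathbb F$. The braid group $B_3$ acts on $\hat H$ as a group of automorphisms such that $a(h)=t_1^{-1}ht_1$ for all $h\in\hat H$ and $b$, $c$ do the following: $$b(t^\vee_0)=t_1^{-1}t^\vee_1t_1,\quad b(t_0)=t^\vee_0,\quad b(t^\vee_1)=t_0,\quad b(t_1)=t_1;$$ $$c(t^\vee_0)=t_1^{-1}t^\vee_1t_1,\quad c(t_0)=t^\vee_0t_0t^{\vee -1}_0,\quad c(t^\vee_1)=t^\vee_0,\quad c(t_1)=t_1.$$
   Context: All algebras are associative with $1$. $\hat H$ is the $\mathbb F$-algebra defined by generators $t_i^{\pm1}$, $(t_i^\vee)^{\pm1}$ $(i=0,1)$ and relations: $t_it_i^{-1}=t_i^{-1}t_i=1$, $t^\vee_it^{\vee -1}_i=t^{\vee -1}_it^\vee_i=1$; $t_i+t_i^{-1}$ is central and $t^\vee_i+t^{\vee -1}_i$ is central $(i=0,1)$; $t^\vee_0t_0t^\vee_1t_1$ is central. Here $t^{\vee -1}_i=(t^\vee_i)^{-1}$. An automorphism of $\hat H$ is an $\mathbb F$-algebra isomorphism $\hat H\to\hat H$. Artin's braid group $B_3$ is the group defined by generators $b,c$ and the relation $b^3=c^2$; put $a=b^3=c^2$. *)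

(* Defs.v *)
From HB Require Import structures.
From mathcomp Require Import all_boot all_algebra.
From mathcomp Require Import boolp.
From mathcomp Require Import monalg.

Set Implicit Arguments.
Unset Strict Implicit.
Unset Printing Implicit Defensive.

Import GRing.Theory.
Local Open Scope ring_scope.
Local Open Scope quotient_scope.

(* The suffix [v] stands for the superscript vee. *)
Inductive Hgen : predArgType := Gt0 | Gt1 | Gt0v | Gt1v.

Definition bool2_of_Hgen (g : Hgen) : bool * bool :=
  match g with
  | Gt0 => (false, false) | Gt1 => (true, false)
  | Gt0v => (false, true) | Gt1v => (true, true)
  end.

Definition Hgen_of_bool2 (p : bool * bool) : Hgen :=
  match p with
  | (false, false) => Gt0 | (true, false) => Gt1
  | (false, true) => Gt0v | (true, true) => Gt1v
  end.

Lemma bool2_of_HgenK : cancel bool2_of_Hgen Hgen_of_bool2.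
Proof. by case. Qed.

HB.instance Definition _ := Countable.copy Hgen (can_type bool2_of_HgenK).

(* The letter [(g, false)] stands for g, and [(g, true)] for g^-1; the monoid
   algebra of the free monoid on these letters is the free associative unital
   F-algebra on the eight symbols t_i^{+-1}, (t_i^vee)^{+-1}. *)
Definition Hletter : choiceType := (Hgen * bool)%type.

Definition free_alg (F : fieldType) := {malg F[{fmonom Hletter}]}.

HB.instance Definition _ (F : fieldType) := GRing.Lalgebra.on (free_alg F).

Lemma free_alg_scalerAr (F : fieldType) (k : F) (x y : free_alg F) :
  k *: (x * y) = x * (k *: y).
Proof.
have comm_kC (z : {malg F[{fmonom Hletter}]}) : k%:MP * z = z * k%:MP.
  rewrite !malgM_def fgmulUg fgmulgU; apply: eq_bigr => m _.
  by rewrite mul1m mulm1 mulrC.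
by rewrite -!mul_malgC [in LHS]mulrA comm_kC -mulrA.
Qed.

HB.instance Definition _ (F : fieldType) :=
  GRing.Lalgebra_isAlgebra.Build F (free_alg F) (@free_alg_scalerAr F).

Inductive ideal_gen (R : nzRingType) (S : R -> Prop) : R -> Prop :=
| ideal_gen0 : ideal_gen S 0
| ideal_genD x y : ideal_gen S x -> ideal_gen S y -> ideal_gen S (x + y)
| ideal_genM x s y : S s -> ideal_gen S (x * s * y).

Section Ideal.
Variables (R : nzRingType) (S : R -> Prop).
Implicit Types x y z : R.

Lemma ideal_genMl z x : ideal_gen S x -> ideal_gen S (z * x).
Proof.
elim=> [|u v _ IHu _ IHv|u s v Ss]; first by rewrite mulr0; exact: ideal_gen0.
  by rewrite mulrDr; exact: ideal_genD.
by rewrite !mulrA; exact: ideal_genM.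
Qed.

Lemma ideal_genMr z x : ideal_gen S x -> ideal_gen S (x * z).
Proof.
elim=> [|u v _ IHu _ IHv|u s v Ss]; first by rewrite mul0r; exact: ideal_gen0.
  by rewrite mulrDl; exact: ideal_genD.
by rewrite -mulrA; exact: ideal_genM.
Qed.

Lemma ideal_genN x : ideal_gen S x -> ideal_gen S (- x).
Proof. by rewrite -mulN1r; exact: ideal_genMl. Qed.

End Ideal.

Section Hhat.
Variable F : fieldType.
Local Notation A := (free_alg F).
Implicit Types x y z : A.

Definition fgen (l : Hletter) : A := << fmu l >>.
Local Notation X g := (fgen (g, false)).
Local Notation Xinv g := (fgen (g, true)).
Local Notation Z := (X Gt0v * X Gt0 * X Gt1v * X Gt1).

(* Each constructor lists elements of the free algebra that become zero; in
   the last two, [x] ranges over the whole free algebra, so that the given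
   element becomes central. *)
Inductive Hrelator : A -> Prop :=
| Hrel_mulV g : Hrelator (X g * Xinv g - 1)
| Hrel_mulVl g : Hrelator (Xinv g * X g - 1)
| Hrel_central g x : Hrelator ((X g + Xinv g) * x - x * (X g + Xinv g))
| Hrel_centralZ x : Hrelator (Z * x - x * Z).

Definition Hideal : A -> Prop := ideal_gen Hrelator.

Definition Hequiv x y : bool := `[< Hideal (x - y) >].

Lemma Hequiv_refl : reflexive Hequiv.
Proof. by move=> x; apply/asboolP; rewrite subrr; exact: ideal_gen0. Qed.

Lemma Hequiv_sym : symmetric Hequiv.
Proof.
by move=> x y; apply/asboolP/asboolP => /ideal_genN; rewrite opprB.
Qed.

Lemma Hequiv_trans : transitive Hequiv.
Proof.
move=> y x z /asboolP Ixy /asboolP Iyz; apply/asboolP.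
by rewrite -(subrKA y); exact: ideal_genD.
Qed.

Canonical Hequiv_equiv :=
  EquivRel Hequiv Hequiv_refl Hequiv_sym Hequiv_trans.

Definition Hhat : Type := {eq_quot Hequiv}.
HB.instance Definition _ := Choice.on Hhat.
HB.instance Definition _ := EqQuotient.on Hhat.

Lemma HhatP x y : \pi_Hhat x = \pi_Hhat y <-> Hideal (x - y).
Proof. by split=> [/eqmodP/asboolP | Ixy]; last exact/eqmodP/asboolP. Qed.

Lemma Hhat_reprK (q : Hhat) : exists x, q = \pi_Hhat x.
Proof. by exists (repr q); rewrite reprK. Qed.

Lemma Hideal_repr x : Hideal (repr (\pi_Hhat x) - x).
Proof. by apply/HhatP; rewrite reprK. Qed.

Definition Hzero : Hhat := \pi_Hhat 0.
Definition Hopp (p : Hhat) : Hhat := \pi_Hhat (- repr p).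
Definition Hadd (p q : Hhat) : Hhat := \pi_Hhat (repr p + repr q).
Definition Hone : Hhat := \pi_Hhat 1.
Definition Hmul (p q : Hhat) : Hhat := \pi_Hhat (repr p * repr q).
Definition Hscale (k : F) (p : Hhat) : Hhat := \pi_Hhat (k *: repr p).

Lemma piN x : Hopp (\pi_Hhat x) = \pi_Hhat (- x).
Proof.
by apply/HhatP; rewrite -opprD; apply: ideal_genN; exact: Hideal_repr.
Qed.

Lemma piD x y : Hadd (\pi_Hhat x) (\pi_Hhat y) = \pi_Hhat (x + y).
Proof.
apply/HhatP; rewrite opprD addrACA.
by apply: ideal_genD; exact: Hideal_repr.
Qed.

Lemma piM x y : Hmul (\pi_Hhat x) (\pi_Hhat y) = \pi_Hhat (x * y).
Proof.
apply/HhatP; set x' := repr _; set y' := repr _.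
have ->: x' * y' - x * y = (x' - x) * y' + x * (y' - y).
  by rewrite mulrBl mulrBr addrA subrK.
by apply: ideal_genD; [apply: ideal_genMr | apply: ideal_genMl];
  exact: Hideal_repr.
Qed.

Lemma piZ k x : Hscale k (\pi_Hhat x) = \pi_Hhat (k *: x).
Proof.
apply/HhatP; rewrite -scalerBr -[_ - x]mul1r scalerAl.
by apply: ideal_genMl; exact: Hideal_repr.
Qed.

Fact HaddA : associative Hadd.
Proof.
move=> p q r; have [[[x ->] [y ->]] [z ->]] :=
  (Hhat_reprK p, Hhat_reprK q, Hhat_reprK r).
by rewrite !piD addrA.
Qed.

Fact HaddC : commutative Hadd.
Proof.
move=> p q; have [[x ->] [y ->]] := (Hhat_reprK p, Hhat_reprK q).
by rewrite !piD addrC.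
Qed.

Fact Hadd0 : left_id Hzero Hadd.
Proof. by move=> p; have [x ->] := Hhat_reprK p; rewrite piD add0r. Qed.

Fact HaddN : left_inverse Hzero Hopp Hadd.
Proof. by move=> p; have [x ->] := Hhat_reprK p; rewrite piN piD addNr. Qed.

HB.instance Definition _ :=
  GRing.isZmodule.Build Hhat HaddA HaddC Hadd0 HaddN.

Fact HmulA : associative Hmul.
Proof.
move=> p q r; have [[[x ->] [y ->]] [z ->]] :=
  (Hhat_reprK p, Hhat_reprK q, Hhat_reprK r).
by rewrite !piM mulrA.
Qed.

Fact Hmul1 : left_id Hone Hmul.
Proof. by move=> p; have [x ->] := Hhat_reprK p; rewrite piM mul1r. Qed.

Fact Hmulr1 : right_id Hone Hmul.
Proof. by move=> p; have [x ->] := Hhat_reprK p; rewrite piM mulr1. Qed.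

Fact HmulDl : left_distributive Hmul Hadd.
Proof.
move=> p q r; have [[[x ->] [y ->]] [z ->]] :=
  (Hhat_reprK p, Hhat_reprK q, Hhat_reprK r).
by rewrite !(piD, piM) mulrDl.
Qed.

Fact HmulDr : right_distributive Hmul Hadd.
Proof.
move=> p q r; have [[[x ->] [y ->]] [z ->]] :=
  (Hhat_reprK p, Hhat_reprK q, Hhat_reprK r).
by rewrite !(piD, piM) mulrDr.
Qed.

(* The one-dimensional representation sending every generator to 1 shows that
   the ideal is proper. *)
Definition fmonom_one (m : {fmonom Hletter}) : F := 1.
Fact fmonom_one_mmorphism : mmorphism fmonom_one.
Proof. by split=> // m n; rewrite /fmonom_one mulr1. Qed.
HB.instance Definition _ :=
  isMultiplicative.Build {fmonom Hletter} F fmonom_one fmonom_one_mmorphism.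

Definition Haug : {rmorphism {malg F[{fmonom Hletter}]} -> F} :=
  mmap idfun fmonom_one.

Lemma Haug_gen l : Haug (fgen l) = 1.
Proof. by rewrite /= mmapU mulr1. Qed.

Lemma Haug_ideal x : Hideal x -> Haug x = 0.
Proof.
elim=> [|u v _ IHu _ IHv|u s v Ss]; first exact: rmorph0.
  by rewrite rmorphD IHu IHv addr0.
suff s0 : Haug s = 0 by rewrite !rmorphM s0 mulr0 mul0r.
case: Ss => [g|g|g w|w]; rewrite rmorphB.
- by rewrite rmorphM rmorph1 !Haug_gen mulr1 subrr.
- by rewrite rmorphM rmorph1 !Haug_gen mulr1 subrr.
- by rewrite !rmorphM mulrC subrr.
- by rewrite !rmorphM mulrC subrr.
Qed.

Fact Hone_neq0 : Hone != 0.
Proof.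
apply/eqP => /HhatP; rewrite subr0 => /Haug_ideal /eqP.
by rewrite rmorph1 oner_eq0.
Qed.

HB.instance Definition _ := GRing.Zmodule_isNzRing.Build Hhat
  HmulA Hmul1 Hmulr1 HmulDl HmulDr Hone_neq0.

Fact HscaleA k l p : Hscale k (Hscale l p) = Hscale (k * l) p.
Proof. by have [x ->] := Hhat_reprK p; rewrite !piZ scalerA. Qed.

Fact Hscale1 : left_id 1 Hscale.
Proof. by move=> p; have [x ->] := Hhat_reprK p; rewrite !piZ scale1r. Qed.

Fact HscaleDr : right_distributive Hscale +%R.
Proof.
move=> k p q; have [[x ->] [y ->]] := (Hhat_reprK p, Hhat_reprK q).
by rewrite /GRing.add /= !(piD, piZ) scalerDr.
Qed.

Fact HscaleDl p : {morph Hscale^~ p : k l / k + l}.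
Proof.
move=> k l; have [x ->] := Hhat_reprK p.
by rewrite /= [RHS]/GRing.add /= !(piD, piZ) scalerDl.
Qed.

HB.instance Definition _ := GRing.Zmodule_isLmodule.Build F Hhat
  HscaleA Hscale1 HscaleDr HscaleDl.

Fact HscaleAl (k : F) (p q : Hhat) : k *: (p * q) = (k *: p) * q.
Proof.
have [[x ->] [y ->]] := (Hhat_reprK p, Hhat_reprK q).
by rewrite /GRing.scale /GRing.mul /= !(piM, piZ) scalerAl.
Qed.

HB.instance Definition _ := GRing.Lmodule_isLalgebra.Build F Hhat HscaleAl.

Fact HscaleAr (k : F) (p q : Hhat) : k *: (p * q) = p * (k *: q).
Proof.
have [[x ->] [y ->]] := (Hhat_reprK p, Hhat_reprK q).
by rewrite /GRing.scale /GRing.mul /= !(piM, piZ) scalerAr.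
Qed.

HB.instance Definition _ := GRing.Lalgebra_isAlgebra.Build F Hhat HscaleAr.

Definition t0 : Hhat := \pi_Hhat (X Gt0).
Definition t1 : Hhat := \pi_Hhat (X Gt1).
Definition t0v : Hhat := \pi_Hhat (X Gt0v).
Definition t1v : Hhat := \pi_Hhat (X Gt1v).
Definition t0_inv : Hhat := \pi_Hhat (Xinv Gt0).
Definition t1_inv : Hhat := \pi_Hhat (Xinv Gt1).
Definition t0v_inv : Hhat := \pi_Hhat (Xinv Gt0v).
Definition t1v_inv : Hhat := \pi_Hhat (Xinv Gt1v).

End Hhat.

Arguments t0 {F}.
Arguments t1 {F}.
Arguments t0v {F}.
Arguments t1v {F}.
Arguments t0_inv {F}.
Arguments t1_inv {F}.
Arguments t0v_inv {F}.
Arguments t1v_inv {F}.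

Inductive B3gen : predArgType := Gb | Gc.

Definition bool_of_B3gen (g : B3gen) : bool := if g is Gb then false else true.
Definition B3gen_of_bool (s : bool) : B3gen := if s then Gc else Gb.
Lemma bool_of_B3genK : cancel bool_of_B3gen B3gen_of_bool.
Proof. by case. Qed.
HB.instance Definition _ := Countable.copy B3gen (can_type bool_of_B3genK).

(* As above, [(g, true)] stands for g^-1. *)
Definition B3word : choiceType := seq (B3gen * bool).

Inductive B3congr : B3word -> B3word -> Prop :=
| B3congr_refl u : B3congr u u
| B3congr_sym u v : B3congr u v -> B3congr v u
| B3congr_trans u v w : B3congr u v -> B3congr v w -> B3congr u w
| B3congr_cat u v u' v' :
    B3congr u u' -> B3congr v v' -> B3congr (u ++ v) (u' ++ v')
| B3congr_cancel g s : B3congr [:: (g, s); (g, ~~ s)] [::]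
| B3congr_braid : B3congr (nseq 3 (Gb, false)) (nseq 2 (Gc, false)).

Definition B3equiv (u v : B3word) : bool := `[< B3congr u v >].

Lemma B3equiv_refl : reflexive B3equiv.
Proof. by move=> u; apply/asboolP; exact: B3congr_refl. Qed.

Lemma B3equiv_sym : symmetric B3equiv.
Proof. by move=> u v; apply/asboolP/asboolP; exact: B3congr_sym. Qed.

Lemma B3equiv_trans : transitive B3equiv.
Proof.
by move=> v u w /asboolP uv /asboolP vw; apply/asboolP/(B3congr_trans uv).
Qed.

Canonical B3equiv_equiv :=
  EquivRel B3equiv B3equiv_refl B3equiv_sym B3equiv_trans.

Definition B3 : Type := {eq_quot B3equiv}.
HB.instance Definition _ := Choice.on B3.
HB.instance Definition _ := EqQuotient.on B3.

Lemma B3P u v : \pi_B3 u = \pi_B3 v <-> B3congr u v.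
Proof. by split=> [/eqmodP/asboolP | uv]; last exact/eqmodP/asboolP. Qed.

Lemma B3_reprK (p : B3) : exists u, p = \pi_B3 u.
Proof. by exists (repr p); rewrite reprK. Qed.

Lemma B3congr_repr u : B3congr (repr (\pi_B3 u)) u.
Proof. by apply/B3P; rewrite reprK. Qed.

Definition inv_word (u : B3word) : B3word :=
  rev [seq (l.1, ~~ l.2) | l <- u].

Lemma inv_word_cat u v : inv_word (u ++ v) = inv_word v ++ inv_word u.
Proof. by rewrite /inv_word map_cat rev_cat. Qed.

Lemma inv_wordK : involutive inv_word.
Proof.
move=> u; rewrite /inv_word map_rev revK -map_comp -[RHS]map_id.
by apply: eq_map => -[g s] /=; rewrite negbK.
Qed.

Lemma inv_word_mulV u : B3congr (u ++ inv_word u) [::].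
Proof.
elim: u => [|[g s] u IHu]; first exact: B3congr_refl.
rewrite -cat1s inv_word_cat -catA [u ++ _]catA.
apply: B3congr_trans (B3congr_cancel g s); rewrite -[in X in B3congr _ X]cat1s.
apply: B3congr_cat; first exact: B3congr_refl.
rewrite -[X in B3congr _ X]cat0s.
by apply: B3congr_cat => //; exact: B3congr_refl.
Qed.

Lemma B3congr_inv u v : B3congr u v -> B3congr (inv_word u) (inv_word v).
Proof.
move=> uv; have lr w w' x y : B3congr w w' -> B3congr (x ++ w ++ y) (x ++ w' ++ y).
  move=> ww'; apply: B3congr_cat; first exact: B3congr_refl.
  by apply: B3congr_cat => //; exact: B3congr_refl.
have Vl w : B3congr (inv_word w ++ w) [::].
  by rewrite -{2}[w]inv_wordK; exact: inv_word_mulV.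
have h1 : B3congr (inv_word u ++ v ++ inv_word v) (inv_word u).
  rewrite -[X in B3congr _ X]cats0.
  by apply: B3congr_cat; [exact: B3congr_refl | exact: inv_word_mulV].
have h2 : B3congr (inv_word u ++ u ++ inv_word v) (inv_word v).
  rewrite catA -[X in B3congr _ X]cat0s.
  by apply: B3congr_cat; [exact: Vl | exact: B3congr_refl].
apply: B3congr_trans (B3congr_sym h1) _; apply: B3congr_trans h2.
by apply: lr; exact: B3congr_sym.
Qed.

Definition B3_one : B3 := \pi_B3 [::].
Definition B3_mul (p q : B3) : B3 := \pi_B3 (repr p ++ repr q).
Definition B3_inv (p : B3) : B3 := \pi_B3 (inv_word (repr p)).

Lemma piB3_mul u v : B3_mul (\pi_B3 u) (\pi_B3 v) = \pi_B3 (u ++ v).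
Proof. by apply/B3P/B3congr_cat; exact: B3congr_repr. Qed.

Lemma piB3_inv u : B3_inv (\pi_B3 u) = \pi_B3 (inv_word u).
Proof. by apply/B3P/B3congr_inv; exact: B3congr_repr. Qed.

Fact B3_mulA : associative B3_mul.
Proof.
move=> p q r; have [[[u ->] [v ->]] [w ->]] :=
  (B3_reprK p, B3_reprK q, B3_reprK r).
by rewrite !piB3_mul catA.
Qed.

Fact B3_mul1g : left_id B3_one B3_mul.
Proof. by move=> p; have [u ->] := B3_reprK p; rewrite piB3_mul. Qed.

Fact B3_mulg1 : right_id B3_one B3_mul.
Proof. by move=> p; have [u ->] := B3_reprK p; rewrite piB3_mul cats0. Qed.

Fact B3_mulgV : right_inverse B3_one B3_inv B3_mul.
Proof.
move=> p; have [u ->] := B3_reprK p; rewrite piB3_inv piB3_mul.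
by apply/B3P; exact: inv_word_mulV.
Qed.

Fact B3_mulVg : left_inverse B3_one B3_inv B3_mul.
Proof.
move=> p; have [u ->] := B3_reprK p; rewrite piB3_inv piB3_mul.
by apply/B3P; rewrite -{2}[u]inv_wordK; exact: inv_word_mulV.
Qed.

HB.instance Definition _ :=
  isGroup.Build B3 B3_mulA B3_mul1g B3_mulg1 B3_mulVg B3_mulgV.

Definition B3_b : B3 := \pi_B3 [:: (Gb, false)].
Definition B3_c : B3 := \pi_B3 [:: (Gc, false)].
Definition B3_a : B3 := (B3_b ^+ 3)%g.

Lemma B3_braid : (B3_b ^+ 3 = B3_c ^+ 2)%g.
Proof.
have expE g n : (\pi_B3 [:: g] ^+ n)%g = \pi_B3 (nseq n g).
  by elim: n => // n IHn; rewrite expgS IHn; exact: piB3_mul.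
by rewrite !expE; apply/B3P; exact: B3congr_braid.
Qed.

(* A left action of [G] on [A] by F-algebra automorphisms. *)
Definition acts_by_automorphisms (G : groupType) (F : fieldType)
    (A : algType F) (act : G -> {lrmorphism A -> A}) : Prop :=
  [/\ forall g, bijective (act g),
      forall h, act 1%g h = h
    & forall g1 g2 h, act (g1 * g2)%g h = act g1 (act g2 h)].

(* Main.v *)
(** Each of [b], [c] respects the defining relations because it replaces the
    generators by conjugates of generators and fixes the central element
    [Z = t0v t0 t1v t1].  On generators both [b^3] and [c^2] are conjugation
    by [t1]; for [c^2 t0] this is the cyclic invariance
    [t1v t1 t0v t0 = Z = t0 t1v t1 t0v], which follows from the centrality
    of [Z].  As conjugation by [t1] is invertible and [b], [c] fix [t1], the
    maps [b], [c] are invertible. *)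

Require Import Defs.
From HB Require Import structures.
From mathcomp Require Import all_boot all_algebra.
From mathcomp Require Import boolp monalg.
Import GRing.Theory.
Local Open Scope ring_scope.
Local Open Scope quotient_scope.

Set Implicit Arguments.
Unset Strict Implicit.
Unset Printing Implicit Defensive.

(** * Central elements and ring morphisms *)

Definition central (R : pzRingType) (z : R) : Prop := forall x, z * x = x * z.

Lemma central_conj (R : pzRingType) (u v z : R) :
  v * u = 1 -> central z -> v * z * u = z.
Proof. by move=> vu cz; rewrite -cz -mulrA vu mulr1. Qed.

(** Evaluate [x' * (x * y) * x] in two ways: cancelling [x' * x] at once gives [y * x], commuting
    the central [x * y] past [x] first gives [x * y]. *)
Lemma central_rot (R : pzRingType) (x x' y : R) :
  x' * x = 1 -> central (x * y) -> y * x = x * y.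
Proof.
move=> x'x cxy; rewrite -[LHS]mul1r -x'x -!mulrA [x * _]mulrA cxy.
by rewrite mulrA x'x mul1r.
Qed.

(* Rewriting these facts directly in [free_alg F] or [Hhat F] makes unification
   unfold the ring operations and diverge; over abstract rings it cannot. *)
Lemma rmorph_commutator0 (R S : pzRingType) (f : {rmorphism R -> S}) x y :
  f (x * y - y * x) = 0 -> f x * f y = f y * f x.
Proof. by move/eqP; rewrite rmorphB !rmorphM subr_eq0 => /eqP. Qed.

Lemma rmorph_central0 (R S : pzRingType) (f : {rmorphism R -> S}) x y :
  central (f x) -> f (x * y - y * x) = 0.
Proof. by move=> cfx; rewrite rmorphB !rmorphM cfx subrr. Qed.

Lemma rmorph_mul1 (R S : pzRingType) (f : {rmorphism R -> S}) x y :
  f x * f y = 1 -> f (x * y - 1) = 0.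
Proof. by move=> fxy; rewrite rmorphB rmorphM rmorph1 fxy subrr. Qed.

(** Uniqueness of inverses: [f y] and [g y] both invert [f x = g x]. *)
Lemma rmorph_inv_eq (R S : pzRingType) (f g : {rmorphism R -> S}) x y :
  x * y = 1 -> y * x = 1 -> f x = g x -> f y = g y.
Proof.
move=> xy yx fgx; rewrite -[LHS]mulr1 -(rmorph1 g) -xy rmorphM -fgx mulrA.
by rewrite -rmorphM yx rmorph1 mul1r.
Qed.

(** Stated for any assignment of the letters, so that it covers both the generators of [Hhat F] and
    their candidate images. *)
Definition Hrelations (A : pzRingType) (v : Hletter -> A) : Prop :=
  [/\ forall g, v (g, false) * v (g, true) = 1,
      forall g, v (g, true) * v (g, false) = 1,
      forall g, central (v (g, false) + v (g, true))
    & central (v (Gt0v, false) * v (Gt0, false)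
               * v (Gt1v, false) * v (Gt1, false))].

(** * Evaluation of the free algebra *)

Section FreeAlgebra.
Variables (F : fieldType) (A : algType F) (v : Hletter -> A).

Definition letter_prod (m : {fmonom Hletter}) : A :=
  \prod_(l <- fmonom_val m) v l.

Fact letter_prod_mmorphism : mmorphism letter_prod.
Proof.
by split=> [m n|]; rewrite /letter_prod ?fmM ?fm1 ?big_nil ?big_cat.
Qed.

HB.instance Definition _ :=
  isMultiplicative.Build {fmonom Hletter} A letter_prod letter_prod_mmorphism.

Lemma letter_prod_fmu l : letter_prod (fmu l) = v l.
Proof. by rewrite /letter_prod fmU big_seq1. Qed.

Definition free_eval : free_alg F -> A := mmap (in_alg A) letter_prod.

Fact free_eval_additive : zmod_morphism free_eval.
Proof. exact: mmapB. Qed.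

HB.instance Definition _ :=
  GRing.isZmodMorphism.Build (free_alg F) A free_eval free_eval_additive.

Fact free_eval_monoid : monoid_morphism free_eval.
Proof.
(* As [A] need not be commutative, the coefficients must commute with the letter products; they do,
   being scalars. *)
have [|fM f1] := @commr_mmap_is_multiplicative _ _ _ (in_alg A) letter_prod.
  by move=> g m m'; rewrite /GRing.comm /= mulr_algl mulr_algr.
by split.
Qed.

HB.instance Definition _ :=
  GRing.isMonoidMorphism.Build (free_alg F) A free_eval free_eval_monoid.

Fact free_eval_scalable : scalable free_eval.
Proof. by move=> k x; rewrite /free_eval mmapZ /= mulr_algl. Qed.

HB.instance Definition _ :=
  GRing.isScalable.Build F (free_alg F) A *:%R free_eval free_eval_scalable.

Lemma free_eval_gen l : free_eval (fgen F l) = v l.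
Proof. by rewrite /free_eval mmapU /= scale1r mul1r letter_prod_fmu. Qed.

End FreeAlgebra.

Lemma fgen_prod (F : fieldType) (s : seq Hletter) :
  << FMonom s >> = \prod_(l <- s) fgen F l :> free_alg F.
Proof.
elim: s => [|l s IHs]; first by rewrite big_nil -fmE.
rewrite big_cons -IHs [RHS]malgM_def fgmulUU mulr1.
by congr (<< _ >>); apply/val_inj; rewrite /= fmM fmU.
Qed.

(** Every element is a linear combination of monomials, and each monomial is a product of
    letters. *)
Lemma free_alg_ext (F : fieldType) (A : algType F)
    (phi psi : {lrmorphism free_alg F -> A}) :
  (forall l, phi (fgen F l) = psi (fgen F l)) -> phi =1 psi.
Proof.
move=> eqL x; rewrite [x]monalgE !linear_sum; apply: eq_bigr => -[s] _.
have -> c : << c *g FMonom s >> = c *: (\prod_(l <- s) fgen F l) :> free_alg F.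
  by rewrite -fgen_prod -mul_malgC malgM_def fgmulUU mulr1 mul1m.
rewrite !linearZ !rmorph_prod; congr (_ *: _); apply: eq_bigr => l _.
exact: eqL.
Qed.

(** * Universal property of the quotient algebra *)

Section Hhat.
Variable F : fieldType.
Local Notation H := (Hhat F).

(** A named copy of the projection, to carry the algebra morphism structure. *)
Definition Hpi (x : free_alg F) : H := \pi_(Hhat F) x.

Fact Hpi_additive : zmod_morphism Hpi.
Proof.
move=> x y; rewrite /Hpi [RHS]/GRing.add /= [X in Hadd _ X]/GRing.opp /=.
by rewrite piN piD.
Qed.

HB.instance Definition _ :=
  GRing.isZmodMorphism.Build (free_alg F) H Hpi Hpi_additive.

Fact Hpi_monoid : monoid_morphism Hpi.
Proof. by split=> [|x y]; [exact: erefl | exact/esym/piM]. Qed.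

HB.instance Definition _ :=
  GRing.isMonoidMorphism.Build (free_alg F) H Hpi Hpi_monoid.

Fact Hpi_scalable : scalable Hpi.
Proof. by move=> k x; exact/esym/piZ. Qed.

HB.instance Definition _ :=
  GRing.isScalable.Build F (free_alg F) H *:%R Hpi Hpi_scalable.

Definition Hgenerator (l : Hletter) : H := Hpi (fgen F l).

Lemma Hpi_relator x : Hrelator x -> Hpi x = 0.
Proof.
move=> Sx; rewrite -[RHS](rmorph0 Hpi); apply/HhatP; rewrite subr0.
by rewrite -[x]mul1r -[1 * x]mulr1; apply: ideal_genM.
Qed.

Lemma Hgenerator_relations : Hrelations Hgenerator.
Proof.
split=> [g|g|g|].
- have /eqP := Hpi_relator (Hrel_mulV F g).
  by rewrite rmorphB rmorphM rmorph1 subr_eq0 => /eqP.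
- have /eqP := Hpi_relator (Hrel_mulVl F g).
  by rewrite rmorphB rmorphM rmorph1 subr_eq0 => /eqP.
- move=> h; have [x ->] : exists x, h = Hpi x by exact: Hhat_reprK.
  have := @rmorph_commutator0 _ _ Hpi _ _ (Hpi_relator (Hrel_central g x)).
  by rewrite rmorphD.
- move=> h; have [x ->] : exists x, h = Hpi x by exact: Hhat_reprK.
  have := @rmorph_commutator0 _ _ Hpi _ _ (Hpi_relator (Hrel_centralZ x)).
  by rewrite !(rmorphM Hpi).
Qed.

(** The evaluation at [v] kills every relator, hence the whole ideal, and so descends to the
    quotient. *)
Lemma Hhat_lift (A : algType F) (v : Hletter -> A) : Hrelations v ->
  exists phi : {lrmorphism H -> A}, forall l, phi (Hgenerator l) = v l.
Proof.
case=> vV Vv vC vZ.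
have ev0 x : Hideal x -> free_eval v x = 0.
  elim=> [|u w _ IHu _ IHw|u s w Ss]; first exact: rmorph0.
    by rewrite rmorphD /= IHu IHw addr0.
  suff s0 : free_eval v s = 0 by rewrite !rmorphM /= s0 mulr0 mul0r.
  case: Ss => [g|g|g z|z].
  - by apply: rmorph_mul1; rewrite /= !free_eval_gen.
  - by apply: rmorph_mul1; rewrite /= !free_eval_gen.
  - by apply: rmorph_central0; rewrite rmorphD /= !free_eval_gen; exact: vC.
  - by apply: rmorph_central0; rewrite 3!rmorphM /= !free_eval_gen; exact: vZ.
(* The induced map is computed on chosen representatives; [fE] shows that the choice does not
   matter, and the morphism laws follow from it. *)
pose f (h : H) := free_eval v (repr h).
have fE x : f (Hpi x) = free_eval v x.
  by apply/eqP; rewrite -subr_eq0 -(rmorphB (free_eval v)) /= ev0 //;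
    apply: Hideal_repr.
have piK h : Hpi (repr h) = h by exact: reprK.
have fB : zmod_morphism f.
  move=> x y; rewrite -[x]piK -[y]piK; move: (repr x) (repr y) => a b.
  by rewrite -(rmorphB Hpi a b) !fE (rmorphB (free_eval v)).
have fM : monoid_morphism f.
  split=> [|x y]; first by rewrite -(rmorph1 Hpi) fE (rmorph1 (free_eval v)).
  rewrite -[x]piK -[y]piK; move: (repr x) (repr y) => a b.
  by rewrite -(rmorphM Hpi a b) !fE (rmorphM (free_eval v)).
have fZ : scalable f.
  move=> k x; rewrite -[x]piK; move: (repr x) => a.
  by rewrite -(Hpi_scalable k a) !fE free_eval_scalable.
pose phi : {lrmorphism H -> A} := HB.pack f
  (GRing.isZmodMorphism.Build _ _ f fB)
  (GRing.isMonoidMorphism.Build _ _ f fM)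
  (GRing.isScalable.Build _ _ _ *:%R f fZ).
by exists phi => l; rewrite /= fE free_eval_gen.
Qed.

(** The values on the inverse letters are forced by [rmorph_inv_eq]. *)
Lemma Hhat_ext (A : algType F) (phi psi : {lrmorphism H -> A}) :
    (forall g, phi (Hgenerator (g, false)) = psi (Hgenerator (g, false))) ->
  phi =1 psi.
Proof.
have [TV VT _ _] := Hgenerator_relations.
move=> eqT h.
have eqL l : phi (Hgenerator l) = psi (Hgenerator l).
  case: l => g []; last exact: eqT.
  exact: (rmorph_inv_eq (TV g) (VT g) (eqT g)).
have [x ->] : exists x, h = Hpi x by exact: Hhat_reprK.
exact: (@free_alg_ext _ _ (phi \o Hpi) (psi \o Hpi)).
Qed.

End Hhat.

(** Packs conjugation as an algebra morphism, so that extensionality on generators can compare it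
    with other morphisms. *)
Lemma inner_lrmorphism (F : fieldType) (A : algType F) (u v : A) :
    u * v = 1 -> v * u = 1 ->
  exists phi : {lrmorphism A -> A}, forall h, phi h = v * h * u.
Proof.
move=> uv vu; pose f (h : A) := v * h * u.
have fB : zmod_morphism f by move=> x y; rewrite /f mulrBr mulrBl.
have fM : monoid_morphism f.
  split=> [|x y]; rewrite /f ?mulr1 // !mulrA.
  by rewrite -[_ * u * v]mulrA uv mulr1.
have fZ : scalable f by move=> k x; rewrite /f -scalerAr -scalerAl.
pose phi : {lrmorphism A -> A} := HB.pack f
  (GRing.isZmodMorphism.Build _ _ f fB)
  (GRing.isMonoidMorphism.Build _ _ f fM)
  (GRing.isScalable.Build _ _ _ *:%R f fZ).
by exists phi.
Qed.

(** * The maps [b] and [c], in an abstract algebra whose operations cannot unfold to those of the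
    quotient *)

Section Automorphisms.
Variables (F : fieldType) (A : algType F) (x : Hletter -> A).
Hypothesis xP : Hrelations x.
Hypothesis x_lift : forall v : Hletter -> A, Hrelations v ->
  exists phi : {lrmorphism A -> A}, forall l, phi (x l) = v l.
Hypothesis x_ext : forall phi psi : {lrmorphism A -> A},
  (forall g, phi (x (g, false)) = psi (x (g, false))) -> phi =1 psi.

Local Notation T g := (x (g, false)).
Local Notation Tinv g := (x (g, true)).
Local Notation Z := (T Gt0v * T Gt0 * T Gt1v * T Gt1).
Local Notation conj h := (Tinv Gt1 * h * T Gt1).

Let Tmulinv g : T g * Tinv g = 1. Proof. by case: xP. Qed.
Let Tinvmul g : Tinv g * T g = 1. Proof. by case: xP. Qed.
Let T_central g : central (T g + Tinv g). Proof. by case: xP. Qed.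
Let Z_central : central Z. Proof. by case: xP. Qed.

Let TinvK g h : h * Tinv g * T g = h.
Proof. by rewrite -mulrA Tinvmul mulr1. Qed.
Let TK g h : h * T g * Tinv g = h.
Proof. by rewrite -mulrA Tmulinv mulr1. Qed.

Lemma Z_rot : T Gt1v * T Gt1 * T Gt0v * T Gt0 = Z.
Proof.
have := @central_rot _ (T Gt0v * T Gt0) (Tinv Gt0 * Tinv Gt0v) (T Gt1v * T Gt1).
by rewrite !mulrA TinvK; apply.
Qed.

Lemma Z_rot0 : T Gt0 * T Gt1v * T Gt1 * T Gt0v = Z.
Proof.
have := @central_rot _ (T Gt0v) (Tinv Gt0v) (T Gt0 * T Gt1v * T Gt1).
by rewrite !mulrA; apply.
Qed.

Lemma conj_sum g : conj (T g) + conj (Tinv g) = T g + Tinv g.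
Proof. by rewrite -mulrDl -mulrDr central_conj. Qed.

(** The sign [s] passes through unchanged because conjugation commutes with inversion. *)
Definition b_letter (l : Hletter) : A :=
  let: (g, s) := l in
  match g with
  | Gt0v => conj (x (Gt1v, s)) | Gt0 => x (Gt0v, s)
  | Gt1v => x (Gt0, s) | Gt1 => x (Gt1, s)
  end.

Definition c_letter (l : Hletter) : A :=
  let: (g, s) := l in
  match g with
  | Gt0v => conj (x (Gt1v, s)) | Gt0 => T Gt0v * x (Gt0, s) * Tinv Gt0v
  | Gt1v => x (Gt0v, s) | Gt1 => x (Gt1, s)
  end.

(** The image of [Z] is the conjugate by [T Gt1] of the rotated product in [Z_rot], that is, of the
    central [Z] itself. *)
Lemma b_relations : Hrelations b_letter.
Proof.
split=> [[]|[]|[]|] //=; rewrite ?mulrA ?(TK, TinvK) ?conj_sum //.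
have := central_conj (Tinvmul Gt1) Z_central.
by rewrite -{1}Z_rot !mulrA => ->.
Qed.

Lemma c_relations : Hrelations c_letter.
Proof.
split=> [[]|[]|[]|] //=; rewrite ?mulrA ?(TK, TinvK) ?conj_sum //.
  (* The sum for [Gt0] is conjugated by [T Gt0v] instead of [T Gt1], so [conj_sum] does not cover
     it. *)
  by rewrite -mulrDl -mulrDr central_conj.
have := central_conj (Tinvmul Gt1) Z_central.
by rewrite -{1}Z_rot !mulrA => ->.
Qed.

(** [b] cycles [Gt0v], [Gt1v], [Gt0], with exactly one conjugation by [T Gt1] per turn. *)
Lemma b_cube (b : {lrmorphism A -> A}) :
  (forall l, b (x l) = b_letter l) -> forall h, b (b (b h)) = conj h.
Proof.
move=> bE; have [phi phiE] := inner_lrmorphism (Tmulinv Gt1) (Tinvmul Gt1).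
move=> h; rewrite -phiE; move: h; apply: (@x_ext (b \o b \o b)) => g.
by rewrite phiE /=; case: g; do !rewrite ?bE /= ?rmorphM ?Tinvmul ?mul1r //.
Qed.

Lemma c_square (c : {lrmorphism A -> A}) :
  (forall l, c (x l) = c_letter l) -> forall h, c (c h) = conj h.
Proof.
move=> cE; have [phi phiE] := inner_lrmorphism (Tmulinv Gt1) (Tinvmul Gt1).
move=> h; rewrite -phiE; move: h; apply: (@x_ext (c \o c)) => g.
rewrite phiE /=; case: g; do !rewrite ?cE /= ?rmorphM ?Tinvmul ?mul1r //.
(* Only [Gt0] remains: its image under [c] twice is the conjugate by [T Gt1] of this product. *)
have rotE : T Gt1v * T Gt1 * T Gt0v * T Gt0 * Tinv Gt0v * Tinv Gt1 * Tinv Gt1v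
          = T Gt0 by rewrite Z_rot -Z_rot0 !TK.
by rewrite -[in RHS]rotE !mulrA.
Qed.

(** With [phi] inverse to [conj], the inverse of [f] is [phi] after the [n]-th iterate of [f]; it is
    two-sided because [f] fixes [T Gt1] and its inverse, hence commutes with [phi]. *)
Lemma lrmorphism_conj_root (f : {lrmorphism A -> A}) (n : nat) :
    f (T Gt1) = T Gt1 -> f (Tinv Gt1) = Tinv Gt1 ->
    (forall h, iter n.+1 f h = conj h) ->
  exists f' : {lrmorphism A -> A}, cancel f f' /\ cancel f' f.
Proof.
move=> fT fTi fn.
have [phi phiE] := inner_lrmorphism (Tinvmul Gt1) (Tmulinv Gt1).
have fphi h : f (phi h) = phi (f h) by rewrite !phiE !rmorphM /= fT fTi.
(* [iter] yields a bare function; the morphism structure is rebuilt by composition. *)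
have [g gE] : exists g : {lrmorphism A -> A}, g =1 iter n f.
  elim: n {fn} => [|n [g gE]]; first by exists idfun.
  by exists (f \o g) => h; rewrite /= gE.
have phiK h : phi (conj h) = h.
  by rewrite phiE !mulrA Tmulinv mul1r TK.
have Kphi h : conj (phi h) = h.
  by rewrite phiE !mulrA Tinvmul mul1r TinvK.
exists (phi \o g); split=> h; rewrite /= gE.
  by rewrite -iterSr fn phiK.
by rewrite fphi -iterS fn phiK.
Qed.

End Automorphisms.

(** * From a pair of automorphisms satisfying the braid relation to an action of [B3] *)

Section B3Action.
Variables (F : fieldType) (A : algType F) (b b' c c' : {lrmorphism A -> A}).
Hypotheses (bK : cancel b b') (b'K : cancel b' b).
Hypotheses (cK : cancel c c') (c'K : cancel c' c).
Hypothesis braid : forall h, b (b (b h)) = c (c h).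

Definition B3_letter_act (l : B3gen * bool) : {lrmorphism A -> A} :=
  match l with
  | (Gb, s) => if s then b' else b
  | (Gc, s) => if s then c' else c
  end.

(** The head letter acts last, which makes concatenation a left action. *)
Fixpoint B3_word_act (u : B3word) : {lrmorphism A -> A} :=
  if u is l :: u' then B3_letter_act l \o B3_word_act u' else idfun.

Lemma B3_word_act_cat u v h :
  B3_word_act (u ++ v) h = B3_word_act u (B3_word_act v h).
Proof. by elim: u => //= l u ->. Qed.

(** Induction on the congruence: cancellation holds by the inverse pairs, and the braid rule by
    [braid]. *)
Lemma B3_word_act_congr u v : B3congr u v -> B3_word_act u =1 B3_word_act v.
Proof.
elim=> {u v} [u|u v _ IH|u v w _ IHuv _ IHvw|u v u' v' _ IHu _ IHv|g s|] h //.
- by rewrite IHuv IHvw.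
- by rewrite !B3_word_act_cat IHv IHu.
- by case: g s => [] [] /=; rewrite ?bK ?b'K ?cK ?c'K.
- exact: braid.
Qed.

Lemma B3_action : exists act : B3 -> {lrmorphism A -> A},
  [/\ acts_by_automorphisms act, act B3_b =1 b & act B3_c =1 c].
Proof.
exists (fun p => B3_word_act (repr p)).
have actE u h : B3_word_act (repr (\pi_B3 u)) h = B3_word_act u h.
  exact/B3_word_act_congr/B3congr_repr.
(* By definition [p * q] is the class of the concatenated representatives, so [actE] applies. *)
have actM (p q : B3) h : B3_word_act (repr (p * q)%g) h
    = B3_word_act (repr p) (B3_word_act (repr q) h).
  by rewrite -B3_word_act_cat; exact: actE.
have act1 h : B3_word_act (repr (1%g : B3)) h = h by exact: actE.
split; [split=> // p | by move=> h; exact: actE ..].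
exists (B3_word_act (repr (p^-1)%g)) => h; rewrite -actM.
  by rewrite mulVg act1.
by rewrite mulgV act1.
Qed.

End B3Action.

Theorem lemma4p2 (F : fieldType) :
  exists act : B3 -> {lrmorphism Hhat F -> Hhat F},
    [/\ acts_by_automorphisms act,
        forall h : Hhat F, act B3_a h = t1_inv * h * t1,
        [/\ act B3_b t0v = t1_inv * t1v * t1,
            act B3_b t0 = t0v,
            act B3_b t1v = t0
          & act B3_b t1 = t1]
      & [/\ act B3_c t0v = t1_inv * t1v * t1,
            act B3_c t0 = t0v * t0 * t0v_inv,
            act B3_c t1v = t0v
          & act B3_c t1 = t1]].
Proof.
have xP := Hgenerator_relations F.
have [b bE] := Hhat_lift (b_relations xP).
have [c cE] := Hhat_lift (c_relations xP).
have b3 := b_cube xP (@Hhat_ext F _) bE.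
have c2 := c_square xP (@Hhat_ext F _) cE.
(* The root lemma counts [n.+1] iterations: [n] is 2 for the cube and 1 for the square. *)
have [b' [bK b'K]] := lrmorphism_conj_root (n := 2) xP (bE _) (bE _) b3.
have [c' [cK c'K]] := lrmorphism_conj_root (n := 1) xP (cE _) (cE _) c2.
have braid h : b (b (b h)) = c (c h) by rewrite b3 c2.
have [act [actP actb actc]] := B3_action bK b'K cK c'K braid.
exists act; split=> //.
- move=> h; have [_ _ actM] := actP.
  by rewrite /B3_a !actM !actb b3.
- by split; rewrite actb; exact: bE.
- by split; rewrite actc; exact: cE.
Qed.
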